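(* Let $\mathcal P$ and $\mathcal Q$ be properties of filtrations such that $\mathcal P\Rightarrow\mathcal Q$ and every $\mathcal Q$-filtration consists of normal subgroups, and assume hypotheses (H0), (H1), (H2), (H3), (H4) of the context. If a $\mathcal Q$-filtration $G_*$ is central (respectively, an $N$-series), then its $\mathcal P$-envelope $G_*^{\mathcal P}$ is central (respectively, an $N$-series) too.
   Context: Commutators are $[a,b]=aba^{-1}b^{-1}$; $[A,B]$ is the subgroup generated by the $[a,b]$, $a\in A$, $b\in B$. A filtration $G_*$ on a group $G$ is a sequence of subgroups $G=G_1\supseteq G_2\supseteq\cdots$. It is central if $[G,G_i]\subseteq G_{i+1}$ for all $i\ge1$, and an $N$-series if $[G_i,G_j]\subseteq G_{i+j}$ for all $i,j\ge1$. Inclusion of filtrations is termwise. If a group $K$ acts on a group $H$ by automorphisms and $H_*$ is a filtration on $H$ by normal subgroups, then for $j\ge1$, $\mathcal A_j(K,H_* )$ is the subgroup of all $k\in K$ such that $k$ and $k^{-1}$ map each $H_i$ into itself and $(k\cdot h)h^{-1}\in H_{i+j}$ for all $i\ge1$, $h\in H_i$; $\mathcal A_*(K,H_* )$ is a filtration on the group $\mathcal A_1(K,H_* )$. Write $\mathcal A_*(H_* )=\mathcal A_*(\mathrm{Aut}(H),H_* )$. Given an action of $K=K_1$ on $H=H_1$, a filtration $K_*$ acts on $H_*$ if $K_j\subseteq\mathcal A_j(K,H_* )$ for all $j\ge1$; then $H_*\rtimes K_*$ is the filtration of $H\rtimes K$ with terms $H_i\rtimes K_i$. For a property $\mathcal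 P$ of filtrations, a $\mathcal P$-filtration is a filtration satisfying $\mathcal P$. The hypotheses are: (H0) If $f\colon K\to G$ is a group morphism and $G_*$ is a $\mathcal P$-filtration on $G$, then $f^{-1}(G_* )$ is a $\mathcal P$-filtration on $K$. (H1) If $G_*$ is a $\mathcal P$-filtration, then so is $\mathcal A_*(G_* )$. (H2) If $K_*$ acts on $H_*$ and both $K_*$ and $H_*$ satisfy $\mathcal P$, then so does $H_*\rtimes K_*$. (H3) For every $\mathcal Q$-filtration $G_*$, there is a smallest $\mathcal P$-filtration $G_*^{\mathcal P}$ (on the same group) containing $G_*$; it is called the $\mathcal P$-envelope of $G_*$. (H4) For every $\mathcal Q$-filtration $G_*$, $\mathcal A_*(G_* )\subseteq\mathcal A_*(G_*^{\mathcal P})$. *)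

(* Defs.v *)
From HB Require Import structures.
From mathcomp Require Import all_boot.
From mathcomp Require Import boolp classical_sets.

Set Implicit Arguments.
Unset Strict Implicit.
Unset Printing Implicit Defensive.

Local Open Scope classical_set_scope.
Local Open Scope group_scope.

(* Groups are MathComp's [groupType], which need not be finite; sets of group
   elements are classical sets (Prop-valued predicates). *)

Definition is_subgroup (G : groupType) (S : set G) : Prop :=
  [/\ S 1, forall x y, S x -> S y -> S (x * y) & forall x, S x -> S x^-1].

Record subgroup (G : groupType) := Subgroup {
  subgroup_set :> set G;
  subgroupP : is_subgroup subgroup_set
}.

Section SubgroupType.
Variables (G : groupType) (S : subgroup G).

Definition subgroup_pred : pred G := fun x => `[< subgroup_set S x >].

Fact subgroup_group_closed : group_closed subgroup_pred.
Proof.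
case: (subgroupP S) => S1 SM SV; split; first exact/asboolP.
by move=> x y /asboolP Sx /asboolP Sy; apply/asboolP/SM => //; exact: SV.
Qed.

Record subgroup_type : Type := SubgroupElt {
  subgroup_elt : G;
  subgroup_eltP : subgroup_pred subgroup_elt
}.

HB.instance Definition _ := [isSub for subgroup_elt].
HB.instance Definition _ := [Choice of subgroup_type by <:].
HB.instance Definition _ :=
  SubChoice_isSubGroup.Build G subgroup_pred subgroup_type subgroup_group_closed.

End SubgroupType.

(* Unlike MathComp's [~ a, b] = a^-1 b^-1 a b. *)
Definition comm (G : groupType) (a b : G) : G := a * b * a^-1 * b^-1.

Definition comm_subgroup (G : groupType) (A B : set G) : set G :=
  smallest (@is_subgroup G)
    [set z | exists2 a, A a & exists2 b, B b & z = comm a b].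

(* The mathematical terms are those of index >= 1; monotonicity from index 0
   forces the term of index 0 to be the whole group, so it carries no data. *)
Record filtration (G : groupType) := Filtration {
  fterm :> nat -> set G;
  fterm_subgroup : forall i, is_subgroup (fterm i);
  fterm1 : fterm 1%N = setT;
  fterm_decr : forall i, fterm i.+1 `<=` fterm i
}.

Definition filtration_property := forall G : groupType, filtration G -> Prop.

Section FiltrationPredicates.
Variable G : groupType.
Implicit Types F E : filtration G.

Definition filtration_sub F E : Prop :=
  forall i, (0 < i)%N -> F i `<=` E i.

Definition normal_filtration F : Prop :=
  forall i, (0 < i)%N -> forall g x, F i x -> F i (g * x * g^-1).

Definition central F : Prop :=
  forall i, (0 < i)%N -> comm_subgroup setT (F i) `<=` F i.+1.

Definition N_series F : Prop :=
  forall i j, (0 < i)%N -> (0 < j)%N ->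
    comm_subgroup (F i) (F j) `<=` F (i + j)%N.

Definition is_envelope (P : filtration_property) F E : Prop :=
  [/\ P G E, filtration_sub F E &
      forall E' : filtration G, P G E' -> filtration_sub F E' ->
        filtration_sub E E'].

End FiltrationPredicates.

Section Preimage.
Variables (K G : groupType) (f : UMagmaMorphism.type K G).

Variable F : filtration G.

Fact preim_is_subgroup i : is_subgroup (f @^-1` F i).
Proof.
case: (fterm_subgroup F i) => S1 SM SV; split=> [|x y|x].
- by rewrite /preimage /= gmulf1.
- by rewrite /preimage /= gmulfM; exact: SM.
- by rewrite /preimage /= gmulfV; exact: SV.
Qed.

Fact preim_fterm1 : f @^-1` F 1%N = setT.
Proof. by rewrite fterm1. Qed.

Fact preim_fterm_decr i : f @^-1` F i.+1 `<=` f @^-1` F i.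
Proof. by move=> x /=; exact: fterm_decr. Qed.

Definition preim_filtration : filtration K :=
  @Filtration K (fun i => f @^-1` F i)
    preim_is_subgroup preim_fterm1 preim_fterm_decr.

End Preimage.

Record gaction (K H : groupType) := GAction {
  gact :> K -> H -> H;
  gact1 : forall h, gact 1 h = h;
  gactM : forall k l h, gact (k * l) h = gact k (gact l h);
  gact_mul : forall k h h', gact k (h * h') = gact k h * gact k h'
}.

Section ActionFiltration.
Variables (K H : groupType) (a : gaction K H) (F : filtration H).

(* Also defined for j = 0, where it is the stabilizer of all the terms; it
   contains [actA 1], so no special case is needed below. *)
Definition actA (j : nat) : set K :=
  [set k | (forall i, (0 < i)%N -> forall h, F i h ->
              F i (a k h) /\ F i (a k^-1 h)) /\
           (forall i, (0 < i)%N -> forall h, F i h ->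
              F (i + j)%N (a k h * h^-1))].

Fact actA_is_subgroup j : is_subgroup (actA j).
Proof.
split.
- split=> i i0 h Fh; first by rewrite invg1 gact1.
  by rewrite gact1 mulgV; case: (fterm_subgroup F (i + j)%N).
- move=> k l [ks kA] [ls lA]; split=> i i0 h Fh.
    rewrite invgM !gactM; split.
      by apply: (ks i i0 _ _).1; exact: (ls i i0 _ Fh).1.
    by apply: (ls i i0 _ _).2; exact: (ks i i0 _ Fh).2.
  rewrite gactM -(mulgVK (a l h) (a k (a l h))) -mulgA.
  case: (fterm_subgroup F (i + j)%N) => _ + _; apply; last exact: lA.
  by apply: kA => //; exact: (ls i i0 _ Fh).1.
- move=> k [ks kA]; split=> i i0 h Fh.
    by rewrite invgK; split; [exact: (ks i i0 _ Fh).2 | exact: (ks i i0 _ Fh).1].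
  have := kA i i0 _ (ks i i0 _ Fh).2; rewrite -gactM mulgV gact1.
  by case: (fterm_subgroup F (i + j)%N) => _ _ FV /FV; rewrite invgM invgK.
Qed.

Fact actA_decr j : actA j.+1 `<=` actA j.
Proof.
move=> k [ks kA]; split=> // i i0 h Fh.
by apply: fterm_decr; rewrite -addnS; exact: kA.
Qed.

Definition actA_group : groupType :=
  subgroup_type (Subgroup (actA_is_subgroup 1%N)).

Definition actA_incl : actA_group -> K := val.

Fact actA_fterm_subgroup j : is_subgroup (actA_incl @^-1` actA j).
Proof.
case: (actA_is_subgroup j) => S1 SM SV; split=> [|x y Sx Sy|x Sx].
- by have e : actA_incl 1 = 1 := val1 _; rewrite /preimage /mkset e.
- have e : actA_incl (x * y) = actA_incl x * actA_incl y := valM x y.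
  by rewrite /preimage /mkset e; exact: SM.
- have e : actA_incl x^-1 = (actA_incl x)^-1 := gmulfV _ x.
  by rewrite /preimage /mkset e; exact: SV.
Qed.

Fact actA_fterm1 : actA_incl @^-1` actA 1%N = setT.
Proof. by rewrite -subTset => x _; exact/asboolP/(valP x). Qed.

Fact actA_fterm_decr j : actA_incl @^-1` actA j.+1 `<=` actA_incl @^-1` actA j.
Proof. by move=> x; exact: actA_decr. Qed.

Definition actA_filtration : filtration actA_group :=
  @Filtration actA_group (fun j => actA_incl @^-1` actA j)
    actA_fterm_subgroup actA_fterm1 actA_fterm_decr.

Definition acts_on (Ks : filtration K) : Prop :=
  forall j, (0 < j)%N -> Ks j `<=` actA j.

End ActionFiltration.

(* The inverse is part of the data; it is determined by the map itself. *)
Record aut (G : groupType) := Aut {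
  aut_fun :> G -> G;
  aut_inv : G -> G;
  aut_funK : cancel aut_fun aut_inv;
  aut_invK : cancel aut_inv aut_fun;
  aut_mul : forall x y, aut_fun (x * y) = aut_fun x * aut_fun y
}.

Section AutGroup.
Variable G : groupType.

HB.instance Definition _ := gen_eqMixin (aut G).
HB.instance Definition _ := gen_choiceMixin (aut G).

Fact aut_eq (f g : aut G) : f =1 g -> f = g.
Proof.
case: f g => [f f' fK f'K fM] [g g' gK g'K gM] /= /funext fg.
subst g; have e : f' = g' by apply/funext => x; rewrite -{1}(g'K x) fK.
by subst g'; congr Aut; exact: Prop_irrelevance.
Qed.

Definition aut_one : aut G := @Aut G id id (fun=> erefl) (fun=> erefl)
  (fun _ _ => erefl).

Fact aut_comp_mul (f g : aut G) x y : f (g (x * y)) = f (g x) * f (g y).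
Proof. by rewrite !aut_mul. Qed.

Definition aut_comp (f g : aut G) : aut G :=
  @Aut G (f \o g) (aut_inv g \o aut_inv f)
    (can_comp (aut_funK f) (aut_funK g)) (can_comp (aut_invK g) (aut_invK f))
    (aut_comp_mul f g).

Fact aut_inv_mul (f : aut G) x y :
  aut_inv f (x * y) = aut_inv f x * aut_inv f y.
Proof. by apply: (can_inj (aut_funK f)); rewrite aut_mul !aut_invK. Qed.

Definition aut_opp (f : aut G) : aut G :=
  @Aut G (aut_inv f) f (aut_invK f) (aut_funK f) (aut_inv_mul f).

Fact aut_compA : associative aut_comp.
Proof. by move=> f g h; exact: aut_eq. Qed.
Fact aut_comp1f : left_id aut_one aut_comp.
Proof. by move=> f; exact: aut_eq. Qed.
Fact aut_compf1 : right_id aut_one aut_comp.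
Proof. by move=> f; exact: aut_eq. Qed.
Fact aut_compVf : left_inverse aut_one aut_opp aut_comp.
Proof. by move=> f; apply: aut_eq => x /=; exact: aut_funK. Qed.
Fact aut_compfV : right_inverse aut_one aut_opp aut_comp.
Proof. by move=> f; apply: aut_eq => x /=; exact: aut_invK. Qed.

HB.instance Definition _ := isGroup.Build (aut G)
  aut_compA aut_comp1f aut_compf1 aut_compVf aut_compfV.

Definition aut_action : gaction (aut G) G :=
  @GAction (aut G) G (@aut_fun G) (fun=> erefl) (fun _ _ _ => erefl)
    (@aut_mul G).

End AutGroup.

Definition autA (G : groupType) (F : filtration G) : nat -> set (aut G) :=
  actA (aut_action G) F.

Definition autA_filtration (G : groupType) (F : filtration G) :=
  actA_filtration (aut_action G) F.

Definition semidirect (K H : groupType) (a : gaction K H) : Type := (H * K)%type.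

Section Semidirect.
Variables (K H : groupType) (a : gaction K H).

Local Notation T := (semidirect a).

HB.instance Definition _ := Choice.on T.

Definition sd_one : T := (1, 1).
Definition sd_mul (x y : T) : T := (x.1 * a x.2 y.1, x.2 * y.2).
Definition sd_inv (x : T) : T := (a x.2^-1 x.1^-1, x.2^-1).

Fact gact_one k : a k 1 = 1.
Proof. by apply: (@mulgI _ (a k 1)); rewrite -gact_mul !mulg1. Qed.

Fact sd_mulA : associative sd_mul.
Proof.
by move=> x y z; rewrite /sd_mul /= gact_mul gactM !mulgA.
Qed.
Fact sd_mul1 : left_id sd_one sd_mul.
Proof. by move=> [h k]; rewrite /sd_mul /= gact1 !mul1g. Qed.
Fact sd_mulr1 : right_id sd_one sd_mul.
Proof. by move=> [h k]; rewrite /sd_mul /= gact_one !mulg1. Qed.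
Fact sd_mulV : left_inverse sd_one sd_inv sd_mul.
Proof.
by move=> [h k]; rewrite /sd_mul /sd_inv /= -gact_mul !mulVg gact_one.
Qed.
Fact sd_mulrV : right_inverse sd_one sd_inv sd_mul.
Proof.
by move=> [h k]; rewrite /sd_mul /sd_inv /= -gactM !mulgV gact1 mulgV.
Qed.

HB.instance Definition _ := isGroup.Build T
  sd_mulA sd_mul1 sd_mulr1 sd_mulV sd_mulrV.

Variables (Hs : filtration H) (Ks : filtration K) (KsHs : acts_on a Hs Ks).

Definition sd_set (i : nat) : set T := [set x | Hs i x.1 /\ Ks i x.2].

Fact sd_stable i k h : Ks i k -> Hs i h -> Hs i (a k h).
Proof.
case: i => [|i] Kk Hh.
  by apply: fterm_decr; rewrite fterm1.
have kT : Ks 1%N k by rewrite fterm1.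
have [s _] : actA a Hs 1 k by exact: KsHs.
exact: (s i.+1 isT h Hh).1.
Qed.

Fact sd_is_subgroup i : is_subgroup (sd_set i).
Proof.
case: (fterm_subgroup Hs i) => H1 HM HV; case: (fterm_subgroup Ks i) => K1 KM KV.
split=> [//|x y [hx kx] [hy ky]|x [hx kx]]; split=> /=.
- by apply: HM => //; exact: sd_stable.
- exact: KM.
- by apply: sd_stable; [exact: KV | exact: HV].
- exact: KV.
Qed.

Fact sd_fterm1 : sd_set 1%N = setT.
Proof. by rewrite -subTset => x _; split; rewrite fterm1. Qed.

Fact sd_fterm_decr i : sd_set i.+1 `<=` sd_set i.
Proof. by move=> x [hx kx]; split; exact: fterm_decr. Qed.

Definition semidirect_filtration : filtration T :=
  Filtration sd_is_subgroup sd_fterm1 sd_fterm_decr.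

End Semidirect.

(* Main.v *)
Require Import Defs.
From HB Require Import structures.
From mathcomp Require Import all_boot.
From mathcomp Require Import boolp classical_sets.

Local Open Scope classical_set_scope.

(** The idea is to let [G] act on itself by conjugation, [c : G -> Aut(G)].
    Since [comm x y = c x y * y^-1], for a filtration [F] by normal subgroups
    being central means that [c] maps [G] into [autA F 1], and being an
    N-series means that [c] maps [F j] into [autA F j] for all [j >= 1]
    ([central_conjP], [N_seriesP]).

    Let [F] be central with envelope [E]. Hypothesis H4 gives
    [autA F 1 `<=` autA E 1], so [c] maps [G] into [autA E 1]: [E] is central.
    If moreover [F] is an N-series, regard [c] as a morphism from [G] to the
    group [autA E 1]. By H1 and H0 the preimages of the subgroups [autA E j]
    form a P-filtration of [G]. It contains [F], again by H4, hence it contains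
    the smallest such filtration [E]. So [c] maps [E j] into [autA E j] for all
    [j >= 1], and [E] is an N-series. *)

Section Conjugation.
Set Implicit Arguments.
Unset Strict Implicit.
Local Open Scope group_scope.
Variable G : groupType.
Implicit Types (F : filtration G) (A B S : set G) (g h : G).

Lemma comm_subgroup_subP A B S : is_subgroup S ->
  comm_subgroup A B `<=` S <-> forall a b, A a -> B b -> S (comm a b).
Proof.
move=> subS; split=> [sAB a b Aa Bb | sAB].
  by apply: sAB; apply: sub_gen_smallest; exists a => //; exists b.
by apply: smallest_sub => // _ [a Aa [b Bb ->]]; exact: sAB.
Qed.

Fact conjugateK g : cancel (fun h => g * h * g^-1) (fun h => g^-1 * h * g).
Proof. by move=> h; rewrite !mulgA mulVg mul1g mulgVK. Qed.

Fact conjugateVK g : cancel (fun h => g^-1 * h * g) (fun h => g * h * g^-1).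
Proof. by move=> h; rewrite !mulgA mulgV mul1g mulgK. Qed.

Fact conjugateM g x y : g * (x * y) * g^-1 = g * x * g^-1 * (g * y * g^-1).
Proof. by rewrite !mulgA mulgVK. Qed.

Definition conj_aut g : aut G :=
  Aut (conjugateK g) (conjugateVK g) (conjugateM g).

Lemma conj_aut1 : conj_aut 1 = 1.
Proof. by apply: aut_eq => x; rewrite /= invg1 mul1g mulg1. Qed.

Lemma conj_autM : {morph conj_aut : g h / g * h}.
Proof. by move=> g h; apply: aut_eq => x; rewrite /= invgM !mulgA. Qed.

(** Normality of the terms takes care of the stability clause in the
    definition of [autA]; only the commutator clause remains. *)
Lemma autA_conjP F j g : normal_filtration F ->
  autA F j (conj_aut g) <->
  forall i, (0 < i)%N -> forall h, F i h -> F (i + j)%N (comm g h).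
Proof.
move=> nF; split=> [[_ +] //|gF]; split=> // i i0 h Fh; split.
  exact: nF.
by have /= := nF i i0 g^-1 h Fh; rewrite invgK.
Qed.

Lemma central_conjP F : normal_filtration F ->
  central F <-> forall g, autA F 1 (conj_aut g).
Proof.
move=> nF; split=> [cF g | cF i i0].
  apply/autA_conjP => // i i0 h Fh; rewrite addn1.
  by apply: (comm_subgroup_subP setT (F i) (fterm_subgroup F _)).1 => //; exact: cF.
apply/comm_subgroup_subP; first exact: fterm_subgroup.
by move=> g h _ Fh; rewrite -addn1; apply: (autA_conjP _ _ nF).1.
Qed.

Lemma N_seriesP F : normal_filtration F ->
  N_series F <-> forall j, (0 < j)%N -> F j `<=` conj_aut @^-1` autA F j.
Proof.
move=> nF; split=> [NF j j0 g Fg | cF i j i0 j0].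
  apply/autA_conjP => // i i0 h Fh; rewrite addnC.
  apply: (comm_subgroup_subP (F j) (F i) (fterm_subgroup F _)).1 => //.
  exact: NF.
apply/comm_subgroup_subP; first exact: fterm_subgroup.
move=> g h Fg Fh; rewrite addnC.
by apply: (autA_conjP _ _ nF).1 => //; exact: cF.
Qed.

Lemma N_series_central F : N_series F -> central F.
Proof. by move=> NF i i0; have := NF 1%N i isT i0; rewrite fterm1. Qed.

Section ConjugationMorphism.
Variables (F : filtration G) (conjF : forall g, autA F 1 (conj_aut g)).

Definition conj_autA g : actA_group (aut_action G) F :=
  @SubgroupElt _ (Subgroup (actA_is_subgroup (aut_action G) F 1))
    (conj_aut g) (asboolT (conjF g)).

Fact conj_autA_morphism : monoid_morphism conj_autA.
Proof.
split=> [|g h]; apply: val_inj; first by rewrite val1 /= conj_aut1.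
by rewrite valM /= conj_autM.
Qed.

HB.instance Definition _ :=
  isUMagmaMorphism.Build _ _ conj_autA conj_autA_morphism.

End ConjugationMorphism.

End Conjugation.

Theorem lemma2p16
  (P Q : filtration_property)
  (PQ : forall (G : groupType) (F : filtration G), P G F -> Q G F)
  (Qnormal : forall (G : groupType) (F : filtration G),
     Q G F -> normal_filtration F)
  (H0 : forall (K G : groupType) (f : UMagmaMorphism.type K G)
          (F : filtration G), P G F -> P K (preim_filtration f F))
  (H1 : forall (G : groupType) (F : filtration G),
     P G F -> P _ (autA_filtration F))
  (H2 : forall (K H : groupType) (a : gaction K H)
          (Hs : filtration H) (Ks : filtration K) (KsHs : acts_on a Hs Ks),
     P K Ks -> P H Hs -> P _ (semidirect_filtration KsHs))
  (H3 : forall (G : groupType) (F : filtration G),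
     Q G F -> exists E : filtration G, is_envelope P F E)
  (H4 : forall (G : groupType) (F E : filtration G),
     Q G F -> is_envelope P F E ->
     forall j, (0 < j)%N -> autA F j `<=` autA E j)
  (G : groupType) (Gs GsP : filtration G) :
  Q G Gs -> is_envelope P Gs GsP ->
  (central Gs -> central GsP) /\ (N_series Gs -> N_series GsP).
Proof.
move=> QGs envGs; have [PGsP _ GsP_min] := envGs.
have nGs := Qnormal _ _ QGs; have nGsP := Qnormal _ _ (PQ _ _ PGsP).
have A_sub := H4 _ _ _ QGs envGs.
have centralGsP : central Gs -> forall g, autA GsP 1 (conj_aut g).
  by move=> /(central_conjP nGs) cGs g; apply: A_sub.
split=> [/centralGsP/(central_conjP nGsP) // | NGs].
have conjGsP := centralGsP (N_series_central NGs).
apply/(N_seriesP nGsP).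
apply: (GsP_min (preim_filtration (conj_autA conjGsP) (autA_filtration GsP))).
  exact/H0/H1.
move=> j j0 g Gsg; apply: A_sub => //.
exact: (N_seriesP nGs).1.
Qed.
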